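(* Let $G$ be a finite simple undirected graph, and let $a/b\in[0,1]$ and $p/q$ be rational numbers written in lowest terms (with $b,q>0$). Then: (1) if $a,b,p,q$ are all odd, $m_{A_{a/b}}(G,p/q)\leq \text{2-}\eta_{\overline{D}+I}(G)=\mathrm{v}_\mathrm{o}(G)$; (2) if $a$ is even and $b,p,q$ are odd, $m_{A_{a/b}}(G,p/q)\leq \text{2-}\eta_{A+I}(G)\leq \theta(G)-\tau(G)+\mathrm{v}_\mathrm{e}(G)+\mathrm{c}(G)$; (3) if $a,b,q$ are odd and $p$ is even, $m_{A_{a/b}}(G,p/q)\leq \text{2-}\eta_{\overline{D}}(G)=\mathrm{v}_\mathrm{e}(G)$; (4) if $a,p$ are even and $b,q$ are odd, $m_{A_{a/b}}(G,p/q)\leq \text{2-}\eta_{A}(G)\leq \theta(G)-\tau(G)+\mathrm{v}_\mathrm{o}(G)+2\mathrm{c}_\mathrm{e}(G)-\mathrm{c}(G)+2i(G)$; (5) if $a$ is odd, $b$ is even and $q$ is odd ($p$ arbitrary), $m_{A_{a/b}}(G,p/q)\leq \text{2-}\eta_{P}(G)\leq \theta(G)-\tau(G)+\mathrm{c}(G)$; (6) if $b$ is odd and $q$ is even ($a,p$ arbitrary), $m_{A_{a/b}}(G,p/q)\leq \text{2-}\eta_{I}=0$.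
   Context: For $\alpha\in[0,1]$, $A_\alpha(G)=\alpha D(G)+(1-\alpha)A(G)$, where $D(G)$ is the diagonal degree matrix and $A(G)$ the adjacency matrix; $m_{A_\alpha}(G,\lambda)$ is the multiplicity of $\lambda$ as an eigenvalue of $A_\alpha(G)$ (the dimension of the real kernel of $A_\alpha(G)-\lambda I$). $\overline{D}(G)$ is the diagonal $\mathbb{F}_2$-matrix whose entries are the vertex degrees mod 2; $P(G)=\overline{D}(G)+A(G)$ over $\mathbb{F}_2$ (the Laplacian reduced mod 2); $\text{2-}\eta_N(G)$ is the dimension of the kernel of the matrix $N$ over $\mathbb{F}_2$. $\mathrm{v}(G),\mathrm{e}(G),\mathrm{c}(G)$ are the numbers of vertices, edges, components; $\mathrm{v}_\mathrm{e}(G),\mathrm{v}_\mathrm{o}(G)$ the numbers of even- and odd-degree vertices; a graph is even if all degrees are even; $\mathrm{c}_\mathrm{e}(G)$ is the number of even components; $i(G)=0$ if $G$ is even and $1$ otherwise; $\theta(G)=\mathrm{e}(G)-\mathrm{v}(G)+\mathrm{c}(G)$; a cycle is odd if it has an odd number of edges, two cycles are disjoint if they share no edge, and $\tau(G)$ is the maximum cardinality of a set of pairwise disjoint odd cycles of $G$. *)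

(* Defs.v *)
From mathcomp Require Import all_boot all_order all_algebra.
From mathcomp Require Import reals.

Set Implicit Arguments.
Unset Strict Implicit.
Unset Printing Implicit Defensive.

Import Order.TTheory GRing.Theory Num.Theory.
Local Open Scope ring_scope.

Record sgraph := SGraph {
  vertex :> finType;
  adj : rel vertex;
  adj_sym : symmetric adj;
  adj_irr : irreflexive adj
}.

Section Graph.
Variable G : sgraph.
Implicit Types (x y : G) (C : {set {set G}}).

Definition edges : {set {set G}} :=
  [set E | [exists x, exists y, adj x y && (E == [set x; y])]].

Definition deg x : nat := #|[set y | adj x y]|.

Definition components : {set {set G}} :=
  equivalence_partition (connect (@adj G)) [set: G].

Definition num_vertices : nat := #|G|.
Definition num_edges : nat := #|edges|.
Definition num_components : nat := #|components|.

Definition num_even_vertices : nat := #|[set x | ~~ odd (deg x)]|.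
Definition num_odd_vertices : nat := #|[set x | odd (deg x)]|.

(* All neighbours of a vertex lie in its component, so [deg] is also the degree
   inside the component; isolated vertices are even components. *)
Definition num_even_components : nat :=
  #|[set K in components | [forall x in K, ~~ odd (deg x)]]|.

Definition even_graph : bool := [forall x : G, ~~ odd (deg x)].
Definition i_graph : nat := if even_graph then 0%N else 1%N.

Definition theta : int :=
  num_edges%:Z - num_vertices%:Z + num_components%:Z.

(* A cycle is represented by its edge set: [c] lists its k >= 3 distinct
   vertices in cyclic order. *)
Definition is_cycle C : bool :=
  [exists k : 'I_#|G|.+1, exists c : k.-tuple G,
    [&& (2 < k)%N, ucycleb (@adj G) c
      & C == [set [set x; next c x] | x in (c : seq G)]]].

Definition is_odd_cycle C : bool := is_cycle C && odd #|C|.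

(* [trivIset S]: distinct cycles of [S] share no edge. *)
Definition tau : nat :=
  \max_(S : {set {set {set G}}} |
          [forall C in S, is_odd_cycle C] && trivIset S) #|S|.

(* Vertices are numbered through [enum_val : 'I_#|G| -> G]. *)
Definition adj_mx (K : pzRingType) : 'M[K]_#|G| :=
  \matrix_(i, j) (adj (enum_val i) (enum_val j))%:R.

Definition deg_mx (K : pzRingType) : 'M[K]_#|G| :=
  diag_mx (\row_i (deg (enum_val i))%:R).

Definition A_alpha (R : realType) (alpha : R) : 'M[R]_#|G| :=
  alpha *: deg_mx R + (1 - alpha) *: adj_mx R.

Definition A2 : 'M['F_2]_#|G| := adj_mx 'F_2.
Definition D2 : 'M['F_2]_#|G| := deg_mx 'F_2.
Definition P2 : 'M['F_2]_#|G| := D2 + A2.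

End Graph.

(* Dimension of the kernel; [kermx] is the row kernel, which for a square
   matrix has the same dimension as the column kernel. *)
Definition nullity (F : fieldType) (n : nat) (M : 'M[F]_n) : nat :=
  \rank (kermx M).

Definition eta2 (n : nat) (N : 'M['F_2]_n) : nat := nullity N.

Definition mult_A_alpha (R : realType) (G : sgraph) (alpha lambda : R) : nat :=
  nullity (A_alpha G alpha - lambda%:M).

(* Main.v *)
(** Clearing denominators, b q (A_(a/b) - p/q) is an integer matrix; a minor that
    is nonzero mod 2 is nonzero, so its real nullity is at most its nullity
    mod 2, and its reduction mod 2 is one of D + I, A + I, D, A, P = D + A, I
    according to the parities of a, b, p, q.

    Let S be a set of vertices, and let B be the vertex-edge incidence matrix
    over F_2 of G with a half-edge {x} added at each x in S, so that
    B B^T = P + diag(S). The left kernel of B consists of the vectors constant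
    on components and zero on S; its dimension c_S is the number of components
    avoiding S. Let C have as rows the edge vectors of t disjoint odd cycles:
    C B^T = 0 and C C^T = I. Sylvester's inequality for the product of the
    stacked matrix (B; C), of rank v - c_S + t, with its transpose, of rank
    rank(P + diag(S)) + t, gives
      nullity(P + diag(S)) <= e - v + 2 c_S + |S| - t.
    Since A = P + D and A + I = P + (D + I), taking for S the empty set, the odd
    vertices or the even vertices gives the bounds for P, A and A + I. *)

Require Import Defs.
From mathcomp Require Import all_boot all_order all_algebra.
From mathcomp Require Import reals.
From mathcomp Require Import ring zify.

Set Implicit Arguments.
Unset Strict Implicit.
Unset Printing Implicit Defensive.

Import Order.TTheory GRing.Theory Num.Theory.
Local Open Scope ring_scope.

(** * Ranks of integer matrices over fields, and parity in ['F_2] *)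

Lemma mxrank_map_intr_le (F : fieldType) (K : numFieldType) m n
    (A : 'M[int]_(m, n)) :
  (\rank (map_mx (intr : int -> F) A) <= \rank (map_mx (intr : int -> K) A))%N.
Proof.
(* [f] selects a row basis of [AF], and [g] as many independent columns of those rows. The resulting
   minor is nonzero in [F], so its integer determinant is nonzero and stays so in [K], of
   characteristic 0. *)
set AF := map_mx _ A; set f := maxrankfun AF.
have full_fAF : row_full (rowsub f AF)^T.
  by have := maxrowsub_free AF; rewrite /row_free /row_full mxrank_tr.
set g := fullrankfun full_fAF.
have detF : \det (mxsub f g AF) != 0.
  have := fullrowsub_unit full_fAF; rewrite -/g trmx_mxsub -mxsub_comp.
  by rewrite -trmx_mxsub unitmx_tr unitmxE unitfE.
have unitK : mxsub f g (map_mx (intr : int -> K) A) \in unitmx.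
  rewrite unitmxE unitfE -map_mxsub det_map_mx intr_eq0.
  apply: contraNneq detF => det0.
  by rewrite -map_mxsub det_map_mx det0.
rewrite -(mxrank_unit unitK) mxsubcr -mxrank_tr trmx_mxsub.
apply: leq_trans (mxrankS (rowsub_sub _ _)) _.
by rewrite mxrank_tr mxrankS ?rowsub_sub.
Qed.

Lemma natr_F2 n : n%:R = (odd n)%:R :> 'F_2.
Proof.
by rewrite -[n in LHS]odd_double_half natrD -mul2n natrM pchar_Fp_0 // mul0r addr0.
Qed.

Lemma addrr_F2 (V : lmodType 'F_2) (v : V) : v + v = 0.
Proof. by rewrite -mulr2n -scaler_nat pchar_Fp_0 // scale0r. Qed.

Lemma intr_F2 (z : int) : z%:~R = (odd `|z|%N)%:R :> 'F_2.
Proof.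
by case: z => n; rewrite ?NegzE ?mulrNz ?(oppr_pchar2 (pchar_Fp _)) // -natr_F2.
Qed.

(** * Incidence matrices over ['F_2] and a rank inequality *)

Definition mem_mx (T : finType) (A : {pred T}) (F : {set {set T}}) :
    'M['F_2]_(#|A|, #|F|) :=
  \matrix_(i < #|A|, k < #|F|) (enum_val i \in (enum_val k : {set T}))%:R.

Lemma mem_mx_mul_tr (T : finType) (A : {pred T}) (F : {set {set T}}) i j :
  (mem_mx A F *m (mem_mx A F)^T) i j =
  #|[set X in F | (enum_val i \in X) && (enum_val j \in X)]|%:R.
Proof.
rewrite mxE -sum1dep_card natr_sum big_mkcondr /= [RHS]big_enum_val.
by apply: eq_bigr => k _; rewrite !mxE; do 2!case: (_ \in _);
  rewrite ?mulr1 ?mulr0.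
Qed.

(** [F] indexes both the columns of the first factor and the rows of the second: vertices are
    matched with edges, then edges with cycles seen as sets of edges. *)
Lemma mem_mx_mul (T : finType) (A : {pred T}) (F : {set {set T}})
    (H : {set {set {set T}}}) i k :
  (mem_mx A F *m mem_mx F H) i k =
  #|[set X in F | (enum_val i \in X) && (X \in (enum_val k : {set {set T}}))]|%:R.
Proof.
rewrite mxE -sum1dep_card natr_sum big_mkcondr /= [RHS]big_enum_val.
by apply: eq_bigr => j _; rewrite !mxE; do 2!case: (_ \in _);
  rewrite ?mulr1 ?mulr0.
Qed.

Lemma mem_mx_tr_mul (T : finType) (A : {pred T}) (F F' : {set {set T}}) k l :
  ((mem_mx A F)^T *m mem_mx A F') k l =
  #|[set x in A | (x \in (enum_val k : {set T})) &&
       (x \in (enum_val l : {set T}))]|%:R.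
Proof.
rewrite mxE -sum1dep_card natr_sum big_mkcondr /= [RHS]big_enum_val.
by apply: eq_bigr => i _; rewrite !mxE; do 2!case: (_ \in _);
  rewrite ?mulr1 ?mulr0.
Qed.

(** The row spaces of [B] and [C] meet only in 0: if x C = y B, then x = x C C^T = y B C^T = 0.
    Hence the stacked matrix [X] has rank [\rank B + t], while X X^T is block diagonal. *)
Lemma mxrank_mul_tr_ge (F : fieldType) m n t (B : 'M[F]_(m, n)) (C : 'M_(t, n)) :
  C *m B^T = 0 -> C *m C^T = 1%:M ->
  (\rank B + \rank B + t <= \rank (B *m B^T) + n)%N.
Proof.
move=> CB0 CC1; set X := col_mx B C.
have XX : X *m X^T = block_mx (B *m B^T) 0 0 1%:M.
  rewrite tr_col_mx mul_col_row CB0 CC1.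
  by rewrite -[B *m C^T]trmxK trmx_mul trmxK CB0 trmx0.
have rX : \rank X = (\rank B + t)%N.
  rewrite -addsmxE mxrank_disjoint_sum.
    congr addn; apply/eqP; rewrite eqn_leq rank_leq_row /=.
    by rewrite -{1}(mxrank1 F t) -CC1 mxrankM_maxl.
  apply/eqP; rewrite -submx0; apply/row_subP=> i; set v := row i _.
  have: (v <= B :&: C)%MS by apply: row_sub.
  rewrite sub_capmx => /andP[/submxP[y def_v] /submxP[x def_v']].
  have x0 : x = 0.
    rewrite -[x]mulmx1 -CC1 mulmxA -def_v' def_v -mulmxA.
    by rewrite -[B *m C^T]trmxK trmx_mul trmxK CB0 trmx0 mulmx0.
  by rewrite def_v' x0 mul0mx sub0mx.
have := mxrank_mul_min X X^T.
by rewrite XX rank_diag_block_mx mxrank1 mxrank_tr rX; lia.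
Qed.

(** Rotating [c] to start at [y] makes the two successors its second and third entries. This keeps
    the edges of a cycle distinct. *)
Lemma next_next_neq (T : eqType) (c : seq T) y :
  uniq c -> (2 < size c)%N -> y \in c -> next c (next c y) != y.
Proof.
move=> uniq_c c_gt2 /rot_to[n c' def_c].
rewrite -!(next_rot n uniq_c) def_c.
have: uniq (y :: c') by rewrite -def_c rot_uniq.
have: (2 < size (y :: c'))%N by rewrite -def_c size_rot.
case: c' {def_c} => [|a [|b c']] //= _.
rewrite !inE !negb_or eqxx => /andP[/and3P[ya yb _] _].
by rewrite [a == y]eq_sym (negPf ya) eqxx eq_sym.
Qed.

Lemma card_setIdU (T : finType) (A B : {set T}) (P : pred T) :
  A :&: B = set0 ->
  #|[set x in A :|: B | P x]| = (#|[set x in A | P x]| + #|[set x in B | P x]|)%N.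
Proof. by move=> AB0; rewrite !setIdE setIUl cardsU -setIIl AB0 set0I cards0 subn0. Qed.

(** * Edges, half-edges and the product B B^T *)

Section GraphMod2.
Variable G : sgraph.
Implicit Types (x y : G) (S : {set G}).

Lemma pair_in_edges x y : ([set x; y] \in edges G) = adj x y.
Proof.
rewrite inE; apply/existsP/idP => [[u /existsP[v /andP[uv /eqP xy]]]|xy].
  have ux : u \in [set x; y] by rewrite xy set21.
  have vx : v \in [set x; y] by rewrite xy set22.
  have {xy} neq_uv : u != v by apply: contraTneq uv => ->; rewrite adj_irr.
  move: ux vx neq_uv uv; rewrite !inE.
  by move=> /orP[] /eqP-> /orP[] /eqP->; rewrite ?eqxx // adj_sym.
by exists x; apply/existsP; exists y; rewrite xy eqxx.
Qed.

Lemma edgesP (E : {set G}) :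
  reflect (exists x y, adj x y /\ E = [set x; y]) (E \in edges G).
Proof.
apply: (iffP idP) => [|[x [y [xy ->]]]]; last by rewrite pair_in_edges.
rewrite inE => /existsP[x /existsP[y /andP[xy /eqP->]]]; by exists x, y.
Qed.

Lemma card_edge (E : {set G}) : E \in edges G -> #|E| = 2.
Proof.
move=> /edgesP[x [y [xy ->]]]; rewrite cards2.
by case: eqP xy => // ->; rewrite adj_irr.
Qed.

(* The singletons act as half-edges: each contributes 1 to a diagonal entry. *)
Definition loop_edges S : {set {set G}} := edges G :|: [set [set x] | x in S].

Lemma disjoint_edges_loops S : edges G :&: [set [set x] | x in S] = set0.
Proof.
apply/setP=> E; rewrite in_setI in_set0; apply/negP=> /andP[/card_edge cE].
by case/imsetP=> x _ def_E; move: cE; rewrite def_E cards1.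
Qed.

Lemma card_loop_edges S : #|loop_edges S| = (num_edges G + #|S|)%N.
Proof.
by rewrite cardsU disjoint_edges_loops cards0 subn0 card_imset //; apply: set1_inj.
Qed.

Lemma card_edges_at x : #|[set E in edges G | x \in E]| = deg x.
Proof.
have inj2 : {in [set y | adj x y] &, injective (fun y => [set x; y])}.
  move=> y z; rewrite !inE => xy xz /setP eq_yz.
  have := eq_yz y; rewrite !inE eqxx orbT; case: (eqVneq y x) => [yx|_] /=.
    by move: xy; rewrite yx adj_irr.
  by move/esym/eqP.
rewrite /deg -(card_in_imset inj2); apply: eq_card => E; rewrite in_set.
apply/andP/imsetP => [[/edgesP[u [v [uv ->]]]]|[y]].
  rewrite !inE => /orP[] /eqP->; first by exists v; rewrite ?inE.
  by exists u; rewrite ?inE 1?adj_sym // setUC.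
by rewrite inE => xy ->; rewrite pair_in_edges xy set21.
Qed.

(** These are the entries of B B^T before reduction mod 2: two distinct vertices share at most the
    edge joining them, and half-edges count only on the diagonal. *)
Lemma card_loop_edges_at S x y :
  #|[set E in loop_edges S | (x \in E) && (y \in E)]| =
  (if x == y then deg x + (x \in S) else adj x y)%N.
Proof.
rewrite /loop_edges card_setIdU ?disjoint_edges_loops //.
have ->: [set E in [set [set z] | z in S] | (x \in E) && (y \in E)] =
    if (x == y) && (x \in S) then [set [set x]] else set0.
  apply/setP=> E; rewrite in_set; apply/andP/idP.
    by case=> /imsetP[z zS ->]; rewrite !inE => /andP[/eqP-> /eqP->];
      rewrite eqxx zS inE.
  case: ifP => [/andP[/eqP<- xS]|_]; rewrite inE // => /eqP->.
  by rewrite set11 imset_f.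
case: eqVneq => [<-|neq_xy] /=.
  congr addn; last by case: (x \in S); rewrite ?cards1 ?cards0.
  by rewrite -card_edges_at; apply: eq_card => E; rewrite !in_set andbb.
rewrite cards0 addn0.
have ->: [set E in edges G | (x \in E) && (y \in E)] =
    if adj x y then [set [set x; y]] else set0.
  apply/setP=> E; rewrite in_set; apply/andP/idP.
    case=> EG /andP[xE yE]; have def_E: E = [set x; y].
      apply/esym/eqP; rewrite eqEcard subUset !sub1set xE yE /=.
      by rewrite (card_edge EG) cards2 neq_xy.
    by move: EG; rewrite def_E pair_in_edges => ->; rewrite set11.
  case: ifP => xy; rewrite inE // => /eqP->.
  by rewrite pair_in_edges xy set21 set22.
by case: (adj x y); rewrite ?cards1 ?cards0.
Qed.

Definition diag_set S : 'M['F_2]_#|G| :=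
  diag_mx (\row_i (enum_val i \in S)%:R).

Lemma loop_edges_mul_tr S :
  mem_mx G (loop_edges S) *m (mem_mx G (loop_edges S))^T = P2 G + diag_set S.
Proof.
apply/matrixP=> i j; rewrite mem_mx_mul_tr card_loop_edges_at !mxE.
rewrite (inj_eq enum_val_inj); case: eqVneq => [<-|_].
  by rewrite adj_irr addr0 natrD.
by rewrite !mulr0n add0r addr0.
Qed.

(** * Components and the left kernel of the incidence matrix *)

Lemma components_equiv :
  {in [set: G] & &, equivalence_rel (connect (@adj G))}.
Proof.
have /sym_connect_sym sC := @adj_sym G.
by move=> x y z _ _ _; split=> [|xy]; rewrite ?connect0 // (same_connect sC xy).
Qed.

Lemma components_partition : partition (components G) [set: G].
Proof. exact: equivalence_partitionP components_equiv. Qed.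

Definition components_avoiding S : {set {set G}} :=
  [set K in components G | [disjoint K & S]].

(** A left kernel vector sums to 0 over each edge, so in characteristic 2 it is constant on
    components; half-edges make it vanish on [S]. The inclusion bounds the rank of [B] from
    below. *)
Lemma kermx_loop_edges S :
  (kermx (mem_mx G (loop_edges S)) <= (mem_mx G (components_avoiding S))^T)%MS.
Proof.
apply/row_subP=> r; set v := row r _.
have vB0 : v *m mem_mx G (loop_edges S) = 0 by apply/sub_kermxP/row_sub.
clearbody v.
pose w x := v 0 (enum_rank x).
have w_sum E : E \in loop_edges S -> \sum_(x in E) w x = 0.
  move=> ES; pose k := enum_rank_in ES E.
  transitivity ((v *m mem_mx G (loop_edges S)) 0 k); last by rewrite vB0 mxE.
  rewrite mxE; transitivity (\sum_(x in G) if x \in E then w x else 0).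
    by rewrite -big_mkcondr; apply: eq_bigl => x; rewrite andTb.
  rewrite big_enum_val; apply: eq_bigr => i _.
  rewrite mxE [enum_val k]enum_rankK_in // /w enum_valK.
  by case: ifP; rewrite ?mulr1 ?mulr0.
have w_adj x y : adj x y -> w x = w y.
  move=> xy; have := w_sum [set x; y].
  rewrite in_setU pair_in_edges xy => /(_ isT); rewrite big_setU1; last first.
    by rewrite inE; apply: contraTneq xy => ->; rewrite adj_irr.
  rewrite big_set1 => /eqP; rewrite addr_eq0 => /eqP->.
  by rewrite (oppr_pchar2 (pchar_Fp _)).
have w_conn x y : connect (@adj G) x y -> w x = w y.
  move=> xy; apply/eqP; rewrite eq_sym.
  (* The level set of [w] through [x] is closed under adjacency, hence under connectivity. *)
  rewrite -[_ == _]/(y \in [pred z | w z == w x]).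
  rewrite -(closed_connect _ xy) ?inE // => z t zt.
  by rewrite !inE (w_adj _ _ zt).
have w_S x : x \in S -> w x = 0.
  move=> xS; rewrite -(w_sum [set x]) ?big_set1 // in_setU imset_f ?orbT //.
have [/eqP cov triv no0] := and3P components_partition.
have conn_pblock x y : (y \in pblock (components G) x) = connect (@adj G) x y.
  by rewrite pblock_equivalence_partition ?inE //; apply: components_equiv.
(* The coefficient of a component is the value of [w] at any of its vertices; the default 0 is never
   taken, components being nonempty. *)
pose u : 'rV_#|components_avoiding S| :=
  \row_k (if [pick x in (enum_val k : {set G})] is Some x then w x else 0).
suff ->: v = u *m (mem_mx G (components_avoiding S))^T by apply: submxMl.
apply/rowP=> i; rewrite [RHS]mxE; set x := enum_val i.
have -> : v 0 i = w x by rewrite /w enum_valK.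
pose wK (K : {set G}) := if [pick y in K] is Some y then w y else 0.
transitivity (\sum_(K in components_avoiding S) wK K * (x \in K)%:R); last first.
  by rewrite big_enum_val; apply: eq_bigr => k _; rewrite !mxE.
have xP : pblock (components G) x \in components G by rewrite pblock_mem ?cov.
(* Only the component of [x] can contribute to the sum; if it meets [S], then [w x] is 0 as well. *)
have [avoid | hit] := boolP (pblock (components G) x \in components_avoiding S).
  rewrite (bigD1 _ avoid) /= big1 ?addr0 => [|K /andP[]].
    rewrite mem_pblock cov inE mulr1 /wK; case: pickP => [y|/(_ x)].
      by rewrite conn_pblock; apply: w_conn.
    by rewrite mem_pblock cov inE.
  move=> /setIdP[KG _] neqK; case: (boolP (x \in K)) => [xK|]; last first.
    by rewrite mulr0.
  by case/eqP: neqK; rewrite (def_pblock triv KG xK).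
rewrite big1 => [|K].
  move: hit; rewrite in_set xP /= => /pred0Pn[y /andP[]] /=.
  by rewrite conn_pblock => /w_conn-> /w_S.
rewrite in_set => /andP[KG KS]; case: (boolP (x \in K)) => [xK|]; last first.
  by rewrite mulr0.
by move: hit; rewrite (def_pblock triv KG xK) in_set KG KS.
Qed.

(** * Odd cycles and the main rank bound *)

Lemma cycle_sub_edges (C : {set {set G}}) : is_cycle C -> C \subset edges G.
Proof.
case/existsP=> k /existsP[c /and3P[_ /andP[cyc _] /eqP->]].
apply/subsetP=> _ /imsetP[x xc ->].
by rewrite pair_in_edges (next_cycle cyc).
Qed.

(** A vertex on the cycle lies on exactly two of its edges, towards its successor and its
    predecessor; any other vertex lies on none. *)
Lemma cycle_even_at (C : {set {set G}}) x :
  is_cycle C -> ~~ odd #|[set E in C | x \in E]|.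
Proof.
case/existsP=> k /existsP[c /and3P[k_gt2 /andP[cyc uniq_c] /eqP->]].
pose f y := [set y; next c y].
(* Two vertices giving the same edge would be each other's successors, against [next_next_neq]. *)
have f_inj : {in c &, injective f}.
  move=> y z yc zc /setP fyz; apply: contraTeq isT => neq_yz.
  have := fyz y; have := fyz z; rewrite !inE !eqxx /= eq_sym (negPf neq_yz) /=.
  move=> /eqP def_z /esym/eqP def_y.
  have := next_next_neq uniq_c _ yc.
  by rewrite size_tuple -def_z -def_y eqxx => /(_ k_gt2).
have -> : [set E in [set f y | y in (c : seq G)] | x \in E] =
    f @: [set y in (c : seq G) | x \in f y].
  apply/setP=> E; rewrite inE; apply/andP/imsetP => [[/imsetP[y yc ->] xy]|].
    by exists y; rewrite // inE yc.
  by case=> y; rewrite inE => /andP[yc xy] ->; rewrite imset_f.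
rewrite card_in_imset; last first.
  by move=> y z; rewrite !in_set => /andP[yc _] /andP[zc _]; apply: f_inj.
have [xc|xNc] := boolP (x \in (c : seq G)).
  have -> : [set y in (c : seq G) | x \in f y] = [set x; prev c x].
    apply/setP=> y; rewrite !inE (eq_sym x y); case: eqVneq => [->|_] /=.
      by rewrite xc.
    apply/andP/eqP => [[yc /eqP->]|->]; first by rewrite prev_next.
    by rewrite mem_prev xc next_prev.
  rewrite cards2; case: eqVneq => // x_prev.
  have := next_cycle cyc xc.
  by rewrite {2}x_prev next_prev // adj_irr.
rewrite (_ : [set y in _ | _] = set0) ?cards0 //.
apply/setP=> y; rewrite !inE; apply: contraNF xNc => /andP[yc].
by case/orP=> /eqP->; rewrite ?mem_next.
Qed.

Lemma eta2_loop_edges_bound S :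
  (eta2 (P2 G + diag_set S) + num_vertices G + tau G <=
   num_edges G + #|components_avoiding S| + #|components_avoiding S| + #|S|)%N.
Proof.
(* The empty family is admissible, so the maximum [tau] is attained. *)
have [Cs /andP[/forall_inP oddCs /trivIsetP trivCs] ->] :
    {Cs : {set {set {set G}}} |
       [forall C in Cs, is_odd_cycle C] && trivIset Cs & tau G = #|Cs|}.
  apply: eq_bigmax_cond; apply/card_gt0P; exists set0.
  rewrite unfold_in; apply/andP; split.
    by apply/forall_inP=> C; rewrite in_set0.
  by apply/trivIsetP=> C C'; rewrite in_set0.
set B := mem_mx G (loop_edges S); set C := (mem_mx (loop_edges S) Cs)^T.
have subCs X : X \in Cs -> X \subset loop_edges S.
  by case/oddCs/andP=> /cycle_sub_edges/subset_trans-> //; apply: subsetUl.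
(* An entry counts the edges of a cycle at a vertex, an even number. *)
have CB0 : C *m B^T = 0.
  rewrite -trmx_mul -trmx0; congr _^T; apply/matrixP=> i k.
  rewrite mem_mx_mul natr_F2 mxE; set X := enum_val k; set x := enum_val i.
  have XCs : X \in Cs := enum_valP k.
  have /negPf even_x := cycle_even_at x (proj1 (andP (oddCs X XCs))).
  rewrite (_ : [set _ in _ | _] = [set E in X | x \in E]) ?even_x //.
  apply/setP=> E; apply/setIdP/setIdP => [[_ /andP[]]|[EX xE]] //.
  by rewrite xE (subsetP (subCs X XCs)).
(* Diagonal entries are odd cycle lengths; the others vanish because distinct cycles of [Cs] share
   no edge. *)
have CC1 : C *m C^T = 1%:M.
  apply/matrixP=> k l; rewrite trmxK mem_mx_tr_mul natr_F2 mxE.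
  have [/andP[_ odd_k] /subCs sub_k] := (oddCs _ (enum_valP k), enum_valP k).
  case: eqVneq => [<-|neq_kl].
    congr (nat_of_bool _)%:R; rewrite -odd_k; congr odd; apply: eq_card => E.
    apply/setIdP/idP => [[_ /andP[]]|Ek] //.
    by rewrite Ek (subsetP sub_k).
  rewrite (_ : [set _ in _ | _] = set0) ?cards0 //.
  apply/setP=> E; rewrite in_set0; apply/negP=> /setIdP[_ /andP[Ek]].
  have /disjointFr-> // : [disjoint (enum_val k : {set {set G}}) & enum_val l].
  apply: trivCs; rewrite ?(inj_eq enum_val_inj) //; exact: enum_valP.
have rB_ge : (#|G| <= \rank B + #|components_avoiding S|)%N.
  rewrite -leq_subLR -mxrank_ker.
  exact: leq_trans (mxrankS (kermx_loop_edges S)) (rank_leq_row _).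
have rX_le := mxrank_mul_tr_ge CB0 CC1; rewrite loop_edges_mul_tr in rX_le.
(* Stated abstractly: [lia] would not identify convertible cardinals. *)
have arith r rB n e s c t h : h = (e + s)%N -> (n <= rB + c)%N ->
    (rB + rB + t <= r + h)%N -> (r <= n)%N -> (n - r + n + t <= e + c + c + s)%N.
  lia.
rewrite /eta2 /nullity mxrank_ker.
exact: arith (card_loop_edges S) rB_ge rX_le (rank_leq_row _).
Qed.

(** * Diagonal matrices over ['F_2] and vertex parities *)

Lemma mxrank_diag_set_le S : (\rank (diag_set S) <= #|S|)%N.
Proof.
pose f (k : 'I_#|S|) : 'I_#|G| := enum_rank (enum_val k : G).
apply: leq_trans (rank_leq_row (rowsub f 1%:M)); apply: mxrankS.
apply/row_subP=> i; rewrite row_diag_mx mxE.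
have [iS|] := boolP (enum_val i \in S); last by rewrite scale0r sub0mx.
rewrite scale1r -row1 (_ : i = f (enum_rank_in iS (enum_val i))).
  by rewrite -row_rowsub row_sub.
by rewrite /f enum_rankK_in // enum_valK.
Qed.

Lemma diag_setC S : diag_set (~: S) = diag_set S + 1%:M.
Proof.
apply/matrixP=> i j; rewrite !mxE in_setC; case: eqP => _; last by rewrite !mulr0n addr0.
by case: (_ \in S); apply/eqP.
Qed.

(** The matrices of [S] and its complement sum to the identity, so subadditivity of rank forces
    equality in both bounds of [mxrank_diag_set_le]. *)
Lemma eta2_diag_set S : eta2 (diag_set S) = #|~: S|.
Proof.
have r_ge := mxrank_add (diag_set S) (diag_set (~: S)).
rewrite {1}diag_setC addrA addrr_F2 add0r mxrank1 in r_ge.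
have arith r r' n s s' : (s + s' = n)%N -> (r <= s)%N -> (r' <= s')%N ->
    (n <= r + r')%N -> (n - r = s')%N by lia.
rewrite /eta2 /nullity mxrank_ker.
exact: arith (cardsC S) (mxrank_diag_set_le _) (mxrank_diag_set_le _) r_ge.
Qed.

Definition odd_vertices : {set G} := [set x | odd (deg x)].

Lemma D2_diag_set : D2 G = diag_set odd_vertices.
Proof.
by apply/matrixP=> i j; rewrite !mxE [in LHS]natr_F2 in_set.
Qed.

Lemma even_verticesE : [set x : G | ~~ odd (deg x)] = ~: odd_vertices.
Proof. by apply/setP=> x; rewrite !in_set. Qed.

Lemma A2_P2_D2 : A2 G = P2 G + D2 G.
Proof. by rewrite /P2 addrC addrA addrr_F2 add0r. Qed.

Lemma card_components_avoiding_le S :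
  (#|components_avoiding S| <= num_components G)%N.
Proof. by apply: subset_leq_card; apply/subsetP=> K /setIdP[]. Qed.

Lemma card_components_avoiding_odd :
  #|components_avoiding odd_vertices| = num_even_components G.
Proof.
apply: eq_card => K; rewrite !in_set; congr andb.
rewrite disjoint_subset; apply/subsetP/forall_inP => [sub x /sub|sub x /sub].
  by rewrite !inE.
by rewrite !inE.
Qed.

(** * From real multiplicities to nullities mod 2 *)

Lemma mult_A_alpha_le (R : realType) (a b p q : int) :
  b != 0 -> q != 0 ->
  (mult_A_alpha G (a%:~R / b%:~R : R) (p%:~R / q%:~R : R) <=
   eta2 (((q * a)%:~R : 'F_2) *: D2 G + ((q * (b - a))%:~R : 'F_2) *: A2 G
         - ((b * p)%:~R)%:M))%N.
Proof.
move=> b0 q0.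
(* [M] is b q (A_(a/b) - p/q); [map_M] reads it over both [R] and ['F_2]. *)
pose M : 'M[int]_#|G| :=
  (q * a) *: deg_mx G int + (q * (b - a)) *: adj_mx G int - (b * p)%:M.
have map_M (K : comNzRingType) : map_mx (intr : int -> K) M =
    (q * a)%:~R *: deg_mx G K + (q * (b - a))%:~R *: adj_mx G K - ((b * p)%:~R)%:M.
  apply/matrixP=> i j; rewrite !mxE rmorphB rmorphD !rmorphM /= !rmorphMn /=.
  by rewrite !rmorph1 !rmorphM.
rewrite /mult_A_alpha /eta2 /nullity.
rewrite !mxrank_ker -map_M leq_sub2l //.
apply: leq_trans (mxrank_map_intr_le _ R M) _.
have bq0 : (b * q)%:~R != 0 :> R by rewrite intr_eq0 mulf_neq0.
rewrite -(mxrank_scale_nz _ bq0) map_M /A_alpha; set X := (X in (\rank X <= _)%N).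
rewrite (_ : X = (b * q)%:~R *: (a%:~R / b%:~R *: deg_mx G R +
  (1 - a%:~R / b%:~R) *: adj_mx G R - (p%:~R / q%:~R)%:M)) // {}/X.
have bR : b%:~R != 0 :> R by rewrite intr_eq0.
have qR : q%:~R != 0 :> R by rewrite intr_eq0.
rewrite scalerBr scalerDr !scalerA scale_scalar_mx !intrM intrB.
congr (_ *: _ + _ *: _ - _%:M); field; rewrite ?bR ?qR //.
Qed.
(** Signs vanish mod 2, and b - a is odd exactly when a and b differ in parity. Substituting
    parities then selects the matrix of each case. *)
Lemma mult_A_alpha_le_parity (R : realType) (a b p q : int) :
  b != 0 -> q != 0 ->
  (mult_A_alpha G (a%:~R / b%:~R : R) (p%:~R / q%:~R : R) <=
   eta2 ((odd `|q|%N && odd `|a|%N)%:R *: D2 G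
         + (odd `|q|%N && (odd `|a|%N (+) odd `|b|%N))%:R *: A2 G
         + ((odd `|b|%N && odd `|p|%N)%:R)%:M))%N.
Proof.
move=> b0 q0; have := mult_A_alpha_le R a p b0 q0; rewrite -raddfN.
have -> : (q * a)%:~R = (odd `|q|%N && odd `|a|%N)%:R :> 'F_2.
  by rewrite intr_F2 abszM oddM.
have -> : (q * (b - a))%:~R =
    (odd `|q|%N && (odd `|a|%N (+) odd `|b|%N))%:R :> 'F_2.
  by rewrite intrM intrB !intr_F2; do 3!case: (odd _); apply/eqP.
have -> // : - (b * p)%:~R = (odd `|b|%N && odd `|p|%N)%:R :> 'F_2.
by rewrite (oppr_pchar2 (pchar_Fp _)) // intr_F2 abszM oddM.
Qed.

(** * Nullity bounds for P, A and A + I *)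

Lemma eta2_P2_bound :
  (eta2 (P2 G))%:Z <= theta G - (tau G)%:Z + (num_components G)%:Z.
Proof.
have diag0 : diag_set set0 = 0.
  by apply/matrixP=> i j; rewrite !mxE in_set0 mul0rn.
have bound : (eta2 (P2 G) + num_vertices G + tau G <=
    num_edges G + #|components_avoiding set0| + #|components_avoiding set0|)%N.
  by have := eta2_loop_edges_bound set0; rewrite diag0 addr0 cards0 addn0.
have := card_components_avoiding_le set0; rewrite /theta; lia.
Qed.

(** With the odd vertices as [S], P + diag(S) is A and the components avoiding [S] are the even
    ones. Since [theta] already contains c, the term 2 c_e comes with - c. *)
Lemma eta2_A2_bound :
  (eta2 (A2 G))%:Z <= theta G - (tau G)%:Z + (num_odd_vertices G)%:Z
    + 2 * (num_even_components G)%:Z - (num_components G)%:Z.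
Proof.
have bound : (eta2 (A2 G) + num_vertices G + tau G <= num_edges G
    + num_even_components G + num_even_components G + num_odd_vertices G)%N.
  have := eta2_loop_edges_bound odd_vertices.
  by rewrite card_components_avoiding_odd -D2_diag_set -A2_P2_D2.
rewrite /theta; lia.
Qed.

(** With the even vertices as [S], diag(S) is D + I. Of the two copies of c bounding 2 c_S, one is
    absorbed by [theta]. *)
Lemma eta2_A2_add1_bound :
  (eta2 (A2 G + 1%:M))%:Z <=
  theta G - (tau G)%:Z + (num_even_vertices G)%:Z + (num_components G)%:Z.
Proof.
pose S := ~: odd_vertices.
have bound : (eta2 (A2 G + 1%:M) + num_vertices G + tau G <= num_edges G
    + #|components_avoiding S| + #|components_avoiding S| + num_even_vertices G)%N.
  have := eta2_loop_edges_bound S; rewrite /num_even_vertices even_verticesE.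
  by rewrite diag_setC -D2_diag_set addrA -A2_P2_D2.
have := card_components_avoiding_le S; rewrite /theta; lia.
Qed.
End GraphMod2.

(** * The six parity cases *)

Theorem theorem11 (R : realType) (G : sgraph) (a b p q : int)
    (b_gt0 : 0 < b) (q_gt0 : 0 < q)
    (coprime_ab : coprimez a b) (coprime_pq : coprimez p q)
    (alpha_ge0 : 0 <= a%:~R / b%:~R :> R)
    (alpha_le1 : a%:~R / b%:~R <= 1 :> R) :
  let m := mult_A_alpha G (a%:~R / b%:~R : R) (p%:~R / q%:~R : R) in
  (* (1) *)
  ([&& odd `|a|%N, odd `|b|%N, odd `|p|%N & odd `|q|%N] ->
     (m <= eta2 (D2 G + 1%:M))%N /\
     eta2 (D2 G + 1%:M) = num_odd_vertices G) /\
  (* (2) *)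
  ([&& ~~ odd `|a|%N, odd `|b|%N, odd `|p|%N & odd `|q|%N] ->
     (m <= eta2 (A2 G + 1%:M))%N /\
     (eta2 (A2 G + 1%:M))%:Z <=
       theta G - (tau G)%:Z + (num_even_vertices G)%:Z
       + (num_components G)%:Z) /\
  (* (3) *)
  ([&& odd `|a|%N, odd `|b|%N, ~~ odd `|p|%N & odd `|q|%N] ->
     (m <= eta2 (D2 G))%N /\
     eta2 (D2 G) = num_even_vertices G) /\
  (* (4) *)
  ([&& ~~ odd `|a|%N, odd `|b|%N, ~~ odd `|p|%N & odd `|q|%N] ->
     (m <= eta2 (A2 G))%N /\
     (eta2 (A2 G))%:Z <=
       theta G - (tau G)%:Z + (num_odd_vertices G)%:Z
       + 2 * (num_even_components G)%:Z - (num_components G)%:Z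
       + 2 * (i_graph G)%:Z) /\
  (* (5) *)
  ([&& odd `|a|%N, ~~ odd `|b|%N & odd `|q|%N] ->
     (m <= eta2 (P2 G))%N /\
     (eta2 (P2 G))%:Z <=
       theta G - (tau G)%:Z + (num_components G)%:Z) /\
  (* (6) *)
  (odd `|b|%N && ~~ odd `|q|%N ->
     (m <= eta2 (1%:M : 'M['F_2]_#|G|))%N /\
     eta2 (1%:M : 'M['F_2]_#|G|) = 0%N).
Proof.
move=> m.
have := mult_A_alpha_le_parity G R a p (lt0r_neq0 b_gt0) (lt0r_neq0 q_gt0).
rewrite -/m => m_le.
(* In case (6) this makes b p odd, so the reduced matrix is I. *)
have odd_p_of_even_q : ~~ odd `|q|%N -> odd `|p|%N.
  move=> even_q; apply: contraLR coprime_pq => even_p.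
  rewrite coprimezE /coprime; apply/eqP=> gcd1.
  by have := dvdn_gcd 2 `|p|%N `|q|%N; rewrite gcd1 !dvdn2 even_p even_q.
split; [|split; [|split; [|split; [|split]]]].
- case/and4P=> oa ob op oq; split.
    by move: m_le; rewrite oa ob op oq /= scale0r addr0 scale1r.
  by rewrite D2_diag_set -diag_setC eta2_diag_set setCK.
- case/and4P=> /negPf oa ob op oq; split; last exact: eta2_A2_add1_bound.
  by move: m_le; rewrite oa ob op oq /= scale0r add0r scale1r.
- case/and4P=> oa ob /negPf op oq; split.
    move: m_le; rewrite oa ob op oq /= scale0r addr0 scale1r.
    by rewrite (_ : 0%:M = 0) ?addr0 //; apply: raddf0.
  by rewrite D2_diag_set eta2_diag_set -even_verticesE.
- case/and4P=> /negPf oa ob /negPf op oq; split.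
    move: m_le; rewrite oa ob op oq /= scale0r add0r scale1r.
    by rewrite (_ : 0%:M = 0) ?addr0 //; apply: raddf0.
  (* The added term 2 i(G) is nonnegative. *)
  by apply: le_trans (eta2_A2_bound G) _; rewrite lerDl mulr_ge0.
- case/and3P=> oa /negPf ob oq; split; last exact: eta2_P2_bound.
  move: m_le; rewrite oa ob oq /= !scale1r.
  by rewrite (_ : 0%:M = 0) ?addr0 //; apply: raddf0.
- case/andP=> ob oq; split; last first.
    by rewrite /eta2 /nullity mxrank_ker mxrank1 subnn.
  move: m_le; rewrite ob (odd_p_of_even_q oq) (negPf oq) /=.
  by rewrite !scale0r !add0r.
Qed.
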